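(* Let $1\le i\le n$ and $\alpha\in F_q^*$. Then $X^{\pm}_{\alpha,i}$ is an absolutely irreducible $FU$-submodule of $X^\pm$ of dimension $q^{n-i}$. Furthermore, if $w$ is the element of $\mathrm{Sp}$ permuting the symplectic basis by the cycles $$w=(u_i,u_n,u_{n-1},\dots,u_{i+1})(v_i,v_n,v_{n-1},\dots,v_{i+1}),$$ then $$X^+_{\alpha,i}\cong\mathrm{ind}_{U_w^+}^{U}FE^+_{\alpha v_i}\cong\mathrm{ind}_{U_w^+}^{U}FE^-_{\alpha v_i}\cong X^-_{\alpha,i},$$ where $FE^\pm_{\alpha v_i}$ affords the linear character $\chi_{\alpha v_i}$ of $U_w^+$.
   Context: Let $F_q$ be a field with $q$ elements, of characteristic $p$ (any prime), $n\ge1$, $V$ a $2n$-dimensional $F_q$-space with a non-degenerate alternating form $\langle\ ,\ \rangle$; $\mathrm{Sp}$ is the group of all $g\in\mathrm{GL}(V)$ preserving the form. Fix a symplectic basis $u_1,\dots,u_n,v_1,\dots,v_n$: $\langle u_i,v_j\rangle=\delta_{ij}$, $\langle u_i,u_j\rangle=\langle v_i,v_j\rangle=0$. Put $M=\mathrm{span}\{u_i\}$, $N=\mathrm{span}\{v_i\}$. $\mathrm{Sp}^M$ is the pointwise stabilizer of $M$, $\mathrm{Sp}_{M,N}$ the subgroup preserving both $M$ and $N$, $\mathrm{Sp}_M=\mathrm{Sp}^M\rtimes\mathrm{Sp}_{M,N}$ the global stabilizer of $M$. $T$ is the group of $g\in\mathrm{Sp}_{M,N}$ whose matrix on $M$ relative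 to $u_1,\dots,u_n$ is upper triangular with 1's on the diagonal (equivalently, whose matrix on $N$ relative to $v_1,\dots,v_n$ is lower triangular with 1's on the diagonal), and $U=T\,\mathrm{Sp}^M$, a Sylow $p$-subgroup of $\mathrm{Sp}$. For $w$ as in the statement, $U_w^+=w^{-1}Uw\cap U$. Cycles are read left to right: $(a,b,c)$ sends $a\mapsto b\mapsto c\mapsto a$. $F$ is a field of characteristic $l\ne p$ containing a primitive $p$-th root of unity, and $\lambda:F_q^+\to F^*$ is a non-trivial linear character. For $v\in V$, $\chi_v(g)=\lambda(\langle gv,v\rangle)$, $g\in\mathrm{Sp}$; restrictions of $\chi_v$ to subgroups are denoted the same way. $X=X_\lambda$ is an $F$-space with basis $(E_v)_{v\in N}$, an $F\mathrm{Sp}_M$-module via $saE_v=\lambda(\langle sav,av\rangle)E_{av}$ ($s\in\mathrm{Sp}^M$, $a\in\mathrm{Sp}_{M,N}$). For $0\neq v\in N$: if $p$ is odd, $E_v^\pm=E_v\pm E_{-v}$; if $p=2$, $E_v^+=E_v^-=E_v$. $X^\pm$ is the span of all $E^\pm_v$, $0\ne v\in N$; it is an $F\mathrm{Sp}_M$-submodule of $X$. For $1\le i\le n$, $\alpha\in F_q^*$, $$X^\pm_{\alpha,i}=\mathrm{span}\{E^\pm_{\alpha v_i+\alpha_{i+1}v_{i+1}+\cdots+\alpha_nv_n}\mid\alpha_j\in F_q\}.$$ *)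

(* Defs.v *)
From HB Require Import structures.
From mathcomp Require Import all_boot all_order all_fingroup all_algebra.
From mathcomp Require Import all_solvable all_field mxrepresentation.
From mathcomp Require Import zify.

Set Implicit Arguments.
Unset Strict Implicit.
Unset Printing Implicit Defensive.

Import GroupScope GRing.Theory.
Local Open Scope ring_scope.

(* Modules are left modules, given by a map into 'End(X) that is              *)
(* multiplicative on G. A submodule is turned into an mx_representation by    *)
(* taking matrices in the column convention (column j holds the coordinates   *)
(* of the image of the j-th basis vector), so that products are preserved in  *)
(* the same order.                                                            *)
Section LeftModules.

Variables (F : fieldType) (gT : finGroupType).

Definition lmod_action (X : vectType F) (G : {group gT}) (rho : gT -> 'End(X)) :=
  rho 1%g = \1%VF
  /\ {in G &, forall g h, rho (g * h)%g = (rho g \o rho h)%VF}.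

Record lmodule (X : vectType F) (G : {group gT}) := LModule {
  lmod_fun :> gT -> 'End(X);
  lmod_funP : lmod_action G lmod_fun
}.

Lemma restr_subproof (X : vectType F) (G H : {group gT}) (rho : lmodule X G) :
  H \subset G -> lmod_action H rho.
Proof.
move=> sHG; case: (lmod_funP rho) => r1 rM; split=> // g h Hg Hh.
by apply: rM; apply: (subsetP sHG).
Qed.

Definition restr_lmod (X : vectType F) (G H : {group gT}) (rho : lmodule X G)
    (sHG : H \subset G) : lmodule X H :=
  LModule (restr_subproof rho sHG).

Variables (X : vectType F) (G : {group gT}) (rho : lmodule X G).

Definition submodule (W : {vspace X}) :=
  {in G, forall g, (rho g @: W <= W)%VS}.

Definition sub_mx (W : {vspace X}) (g : gT) : 'M[F]_(\dim W) :=
  \matrix_(i, j) coord (vbasis W) i (rho g (vbasis W)`_j).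

Lemma sub_mx_repr W : submodule W -> mx_repr G (sub_mx W).
Proof.
move=> modW; case: (lmod_funP rho) => r1 rM.
have fW := basis_free (vbasisP W).
split=> [|g h Gg Gh]; apply/matrixP=> i j; rewrite !mxE.
  by rewrite r1 id_lfunE coord_free // eq_sym -val_eqE.
have hW : rho h (vbasis W)`_j \in W.
  by apply: (subvP (modW h Gh)); rewrite memv_img // vbasis_mem // mem_nth ?size_tuple.
rewrite rM // comp_lfunE {1}(coord_vbasis hW) linear_sum linear_sum /=.
by apply: eq_bigr => k _; rewrite !mxE !linearZ /= mulrC.
Qed.

Definition sub_repr W (modW : submodule W) : mx_representation F G (\dim W) :=
  MxRepresentation (sub_mx_repr modW).

Definition affords_lin_char (e : X) (chi : gT -> F) :=
  [/\ e != 0, {in G &, {morph chi : g h / (g * h)%g >-> g * h}}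
    & {in G, forall g, rho g e = chi g *: e}].

End LeftModules.

(* The matrix form of FG (x)_FH W: for left coset representatives t_k and     *)
(* g t_l = t_k h with h in H, one has g (t_l (x) w) = t_k (x) h w.            *)
Section Induced.

Variables (F : fieldType) (gT : finGroupType) (H G : {group gT}).
Variables (d : nat) (rH : mx_representation F H d).

Definition lcoset_rep (k : 'I_#|lcosets H G|) : gT := repr (enum_val k).

Definition ind_block (g : gT) (k l : 'I_#|lcosets H G|) : 'M[F]_d :=
  let h := ((lcoset_rep k)^-1 * g * lcoset_rep l)%g in
  if h \in H then rH h else 0.

Definition ind_mx (g : gT) : 'M[F]_(\sum_(k < #|lcosets H G|) d) :=
  \mxblock_(k, l) ind_block g k l.

Hypothesis sHG : H \subset G.

Lemma lcoset_repP k :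
  lcoset_rep k \in G /\ enum_val k = (lcoset_rep k *: H)%g.
Proof.
have /lcosetsP[x Gx Ek] := enum_valP k.
have : lcoset_rep k \in (x *: H)%g.
  by rewrite /lcoset_rep Ek (mem_repr x) // lcoset_refl.
move=> tk; split; last by rewrite Ek; apply/esym/lcoset_eqP.
by case/lcosetP: tk => h Hh ->; rewrite groupM // (subsetP sHG).
Qed.

Lemma lcoset_rep_inj k l :
  ((lcoset_rep k)^-1 * lcoset_rep l \in H)%g = (k == l).
Proof.
rewrite -mem_lcoset; apply/idP/eqP=> [/lcoset_eqP E|->]; last exact: lcoset_refl.
by apply: enum_val_inj; rewrite (proj2 (lcoset_repP k)) (proj2 (lcoset_repP l)).
Qed.

Lemma ind_mx_repr : mx_repr G ind_mx.
Proof.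
split=> [|g h Gg Gh].
  have -> : 1%:M = \mxblock_(k, l) (if k == l then 1%:M else 0 : 'M[F]_d)
      :> 'M[F]_(\sum_(k < #|lcosets H G|) d).
    apply/matrixP=> i j; rewrite !mxE.
    have -> : (i == j) = (tagnat.sig i == tagnat.sig j).
      by rewrite (can_eq (@tagnat.sigK _ _)).
    rewrite /tagnat.sig1 /tagnat.sig2.
    case: (tagnat.sig i) (tagnat.sig j) => [k x] [l y] /=.
    rewrite -tag_eqE /tag_eq /=; case: eqP => [E|_]; last by rewrite mxE.
    by case: l / E y => y; rewrite tagged_asE mxE.
  apply: eq_mxblock => k l; rewrite /ind_block mulg1 lcoset_rep_inj.
  by case: eqP => // ->; rewrite mulVg repr_mx1.
rewrite mul_mxblock; apply: eq_mxblock => k l.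
have Ghl : (h * lcoset_rep l)%g \in G by rewrite groupM // (proj1 (lcoset_repP l)).
have cosG : ((h * lcoset_rep l) *: H)%g \in lcosets H G.
  by apply/lcosetsP; exists (h * lcoset_rep l)%g.
pose m := enum_rank_in cosG ((h * lcoset_rep l) *: H)%g.
have Em : ((h * lcoset_rep l) *: H)%g = (lcoset_rep m *: H)%g.
  by rewrite -(proj2 (lcoset_repP m)) enum_rankK_in.
have Hm j : ((lcoset_rep j)^-1 * h * lcoset_rep l \in H)%g = (j == m).
  rewrite -lcoset_rep_inj -mulgA -!mem_lcoset.
  by apply/lcoset_eqP/lcoset_eqP; rewrite Em.
rewrite (bigD1 m) //= big1 ?addr0 => [|j jm]; last first.
  by rewrite {2}/ind_block /= Hm (negbTE jm) mulmx0.
rewrite {3}/ind_block /= Hm eqxx.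
have Hh : ((lcoset_rep m)^-1 * h * lcoset_rep l)%g \in H by rewrite Hm.
have -> : ind_block (g * h) k l =
   if ((lcoset_rep k)^-1 * g * lcoset_rep m)%g \in H
   then rH (((lcoset_rep k)^-1 * g * lcoset_rep m)
            * ((lcoset_rep m)^-1 * h * lcoset_rep l))%g else 0.
  rewrite /ind_block /=.
  have -> : ((lcoset_rep k)^-1 * (g * h) * lcoset_rep l =
     ((lcoset_rep k)^-1 * g * lcoset_rep m)
            * ((lcoset_rep m)^-1 * h * lcoset_rep l))%g.
    by rewrite !mulgA mulgK.
  by rewrite groupMr.
rewrite /ind_block /=; case: ifP => [Hk|_]; last by rewrite mul0mx.
by rewrite repr_mxM.
Qed.

Definition ind_repr : mx_representation F G (\sum_(k < #|lcosets H G|) d) :=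
  MxRepresentation ind_mx_repr.

End Induced.

(* V is the space of column vectors of length 2(n+1): the rank written n in   *)
(* the mathematics is n.+1 here, and the indices 1..n become 0..n.            *)
Section Symplectic.

Variables (K : finFieldType) (n : nat).

Local Notation V := 'cV[K]_(n.+1 + n.+1).
Local Notation gT := {'GL_(n.+1 + n.+1)[K]}.

Definition form (x y : V) : K :=
  \sum_(i < n.+1) (x (lshift n.+1 i) 0 * y (rshift n.+1 i) 0
                   - x (rshift n.+1 i) 0 * y (lshift n.+1 i) 0).

Definition u (i : 'I_n.+1) : V := delta_mx (lshift n.+1 i) 0.
Definition v (i : 'I_n.+1) : V := delta_mx (rshift n.+1 i) 0.

Definition glmx (g : gT) : 'M[K]_(n.+1 + n.+1) := GLval g.
Definition app (g : gT) (x : V) : V := glmx g *m x.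

Definition Mspace : {vspace V} := <<[seq u i | i : 'I_n.+1]>>%VS.
Definition Nspace : {vspace V} := <<[seq v i | i : 'I_n.+1]>>%VS.

Lemma app1 x : app 1%g x = x. Proof. exact: mul1mx. Qed.
Lemma appM g h x : app (g * h)%g x = app g (app h x).
Proof. by rewrite /app mulmxA. Qed.
Lemma appK g : cancel (app g) (app g^-1%g).
Proof. by move=> x; rewrite -appM mulVg app1. Qed.
Lemma appVK g : cancel (app g^-1%g) (app g).
Proof. by move=> x; rewrite -appM mulgV app1. Qed.

Definition Sp_set : {set gT} :=
  [set g | [forall x, forall y, form (app g x) (app g y) == form x y]].

Lemma SpP g : reflect (forall x y, form (app g x) (app g y) = form x y)
                      (g \in Sp_set).
Proof.
rewrite inE; apply: (iffP forallP) => [H x y|H x].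
  by have /forallP/(_ y)/eqP := H x.
by apply/forallP=> y; rewrite H.
Qed.

Lemma Sp_group_set : group_set Sp_set.
Proof.
apply/group_setP; split=> [|g h /SpP Hg /SpP Hh]; apply/SpP=> x y.
  by rewrite !app1.
by rewrite !appM Hg Hh.
Qed.
Canonical Sp_group := Group Sp_group_set.

Definition preserves (g : gT) (W : {vspace V}) :=
  [forall x, (x \in W) ==> (app g x \in W)].

Lemma preservesP g (W : {vspace V}) :
  reflect {in W, forall x, app g x \in W} (preserves g W).
Proof. exact: 'forall_implyP. Qed.

Definition SpMN_set : {set gT} :=
  [set g in Sp_group | preserves g Mspace & preserves g Nspace].

Lemma SpMNP g : reflect [/\ g \in Sp_group, {in Mspace, forall x, app g x \in Mspace}
                          & {in Nspace, forall x, app g x \in Nspace}]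
                        (g \in SpMN_set).
Proof.
rewrite [_ \in SpMN_set]in_set; apply: (iffP and3P) => -[Sg gM gN]; split=> //;
  by [apply/preservesP].
Qed.

Lemma SpMN_group_set : group_set SpMN_set.
Proof.
apply/group_setP; split=> [|g h /SpMNP[Sg gM gN] /SpMNP[Sh hM hN]]; apply/SpMNP.
  by split=> // x; rewrite app1.
by split=> [|x Wx|x Wx]; rewrite ?groupM // appM ?gM ?gN ?hM ?hN.
Qed.
Canonical SpMN_group := Group SpMN_group_set.

Definition SpM_set : {set gT} := [set g in Sp_group | preserves g Mspace].

Lemma SpMP g : reflect (g \in Sp_group /\ {in Mspace, forall x, app g x \in Mspace})
                       (g \in SpM_set).
Proof.
rewrite [_ \in SpM_set]in_set; apply: (iffP andP) => -[Sg gM]; split=> //; exact/preservesP.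
Qed.

Lemma SpM_group_set : group_set SpM_set.
Proof.
apply/group_setP; split=> [|g h /SpMP[Sg gM] /SpMP[Sh hM]]; apply/SpMP.
  by split=> // x; rewrite app1.
by split=> [|x Mx]; rewrite ?groupM // appM gM ?hM.
Qed.
Canonical SpM_group := Group SpM_group_set.

Definition SpM_pt_set : {set gT} :=
  [set g in Sp_group | [forall x, (x \in Mspace) ==> (app g x == x)]].

Lemma SpM_ptP g : reflect (g \in Sp_group /\ {in Mspace, forall x, app g x = x})
                          (g \in SpM_pt_set).
Proof.
rewrite [_ \in SpM_pt_set]in_set; apply: (iffP andP) => -[Sg H]; split=> //.
  by move=> x Mx; have /forallP/(_ x)/implyP/(_ Mx)/eqP := H.
by apply/forallP=> x; apply/implyP=> Mx; rewrite H.
Qed.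

Lemma SpM_pt_group_set : group_set SpM_pt_set.
Proof.
apply/group_setP; split=> [|g h /SpM_ptP[Sg gM] /SpM_ptP[Sh hM]]; apply/SpM_ptP.
  by split=> // x _; rewrite app1.
by split=> [|x Mx]; rewrite ?groupM // appM hM ?gM.
Qed.
Canonical SpM_pt_group := Group SpM_pt_group_set.

(* For g preserving M, ulsubmx (glmx g) is the matrix of g on M relative to   *)
(* the u_i, in the column convention.                                         *)
Definition upper_unitriangular (A : 'M[K]_n.+1) :=
  [forall k : 'I_n.+1, forall j : 'I_n.+1, (j <= k)%N ==> (A k j == (k == j)%:R)].

Definition T_set : {set gT} :=
  [set g in SpMN_group | upper_unitriangular (ulsubmx (glmx g))].

Definition U_set : {set gT} := (T_set * SpM_pt_set)%g.

Lemma mem_Mspace x : (x \in Mspace) = (dsubmx x == 0).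
Proof.
apply/idP/eqP=> [|x0].
  move=> /coord_span ->; rewrite linear_sum big1 // => i _.
  rewrite linearZ /=; set y := _`_i.
  have /mapP[j _ ->] : y \in [seq u i | i : 'I_n.+1] by rewrite mem_nth ?size_tuple.
  rewrite [dsubmx _](_ : _ = 0) ?scaler0 //.
  by apply/matrixP=> a b; rewrite !mxE eq_rlshift.
have -> : x = \sum_i x (lshift n.+1 i) 0 *: u i.
  apply/matrixP=> a b; rewrite ord1 summxE {b}.
  case: (split_ordP a) => k ->.
    rewrite (bigD1 k) //= big1 ?addr0 => [|j jk]; rewrite !mxE eqxx ?mulr1 //.
    by rewrite eq_lshift eq_sym (negbTE jk) mulr0.
  rewrite big1 => [|j _]; last by rewrite !mxE eq_rlshift mulr0.
  by move/matrixP/(_ k 0): x0; rewrite !mxE.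
by apply: memv_suml => i _; rewrite memvZ // memv_span // map_f ?mem_enum.
Qed.

Lemma mem_Nspace x : (x \in Nspace) = (usubmx x == 0).
Proof.
apply/idP/eqP=> [|x0].
  move=> /coord_span ->; rewrite linear_sum big1 // => i _.
  rewrite linearZ /=; set y := _`_i.
  have /mapP[j _ ->] : y \in [seq v i | i : 'I_n.+1] by rewrite mem_nth ?size_tuple.
  rewrite [usubmx _](_ : _ = 0) ?scaler0 //.
  by apply/matrixP=> a b; rewrite !mxE eq_lrshift.
have -> : x = \sum_i x (rshift n.+1 i) 0 *: v i.
  apply/matrixP=> a b; rewrite ord1 summxE {b}.
  case: (split_ordP a) => k ->.
    rewrite big1 => [|j _]; last by rewrite !mxE eq_lrshift mulr0.
    by move/matrixP/(_ k 0): x0; rewrite !mxE.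
  rewrite (bigD1 k) //= big1 ?addr0 => [|j jk]; rewrite !mxE eqxx ?mulr1 //.
  by rewrite eq_rshift eq_sym (negbTE jk) mulr0.
by apply: memv_suml => i _; rewrite memvZ // memv_span // map_f ?mem_enum.
Qed.

Lemma formE x y : form x y =
  ((usubmx x)^T *m dsubmx y - (dsubmx x)^T *m usubmx y) 0 0.
Proof.
by rewrite !mxE -sumrB; apply: eq_bigr => i _; rewrite !mxE.
Qed.

Lemma formBr x y z : form x (y - z) = form x y - form x z.
Proof.
rewrite /form -sumrB; apply: eq_bigr => i _; rewrite !mxE !mulrBr.
by rewrite !opprD !opprK addrACA.
Qed.

Lemma formDl x y z : form (x + y) z = form x z + form y z.
Proof.
rewrite /form -big_split; apply: eq_bigr => i _; rewrite !mxE !mulrDl.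
by rewrite opprD addrACA.
Qed.

Lemma form_alt x : form x x = 0.
Proof. by rewrite /form big1 // => i _; rewrite mulrC subrr. Qed.

Lemma form_u i x : form (u i) x = x (rshift n.+1 i) 0.
Proof.
rewrite /form (bigD1 i) //= big1 ?addr0 => [|j ji]; rewrite !mxE.
  by rewrite !eqxx mul1r eq_rlshift mul0r subr0.
by rewrite eq_lshift (negbTE ji) eq_rlshift !mul0r subr0.
Qed.

Lemma form_v i x : form (v i) x = - x (lshift n.+1 i) 0.
Proof.
rewrite /form (bigD1 i) //= big1 ?addr0 => [|j ji]; rewrite !mxE.
  by rewrite !eqxx mul1r eq_lrshift mul0r sub0r.
by rewrite eq_rshift (negbTE ji) eq_lrshift !mul0r subr0.
Qed.

Lemma symplectic_basis i j :
  [/\ form (u i) (v j) = (i == j)%:R, form (u i) (u j) = 0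
    & form (v i) (v j) = 0].
Proof.
by rewrite !form_u form_v !mxE eq_rshift eq_rlshift eq_lrshift andbT oppr0.
Qed.

Lemma Mspace_u i : u i \in Mspace.
Proof. by rewrite memv_span // map_f ?mem_enum. Qed.

Lemma Mspace_ortho x : (forall i, form (u i) x = 0) -> x \in Mspace.
Proof.
move=> H; rewrite mem_Mspace; apply/eqP/matrixP=> i j.
by rewrite ord1 !mxE -form_u H.
Qed.

Lemma form_Mspace x y : x \in Mspace -> y \in Mspace -> form x y = 0.
Proof.
rewrite !mem_Mspace => /eqP x0 /eqP y0.
by rewrite formE x0 y0 trmx0 mulmx0 mul0mx subr0 mxE.
Qed.

Lemma SpM_ptB s x : s \in SpM_pt_group -> app s x - x \in Mspace.
Proof.
move=> /SpM_ptP[/SpP Ss sM]; apply: Mspace_ortho => i.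
by rewrite formBr -{1}(sM _ (Mspace_u i)) Ss subrr.
Qed.

Lemma app_u g j k : app g (u j) k 0 = glmx g k (lshift n.+1 j).
Proof. by rewrite /app /u -colE mxE. Qed.
Lemma app_v g j k : app g (v j) k 0 = glmx g k (rshift n.+1 j).
Proof. by rewrite /app /v -colE mxE. Qed.

Lemma SpM_dl g : g \in SpM_group -> dlsubmx (glmx g) = 0.
Proof.
move=> /SpMP[_ /(_ _ (Mspace_u _)) gM]; apply/matrixP=> i j.
have := gM j; rewrite mem_Mspace => /eqP/matrixP/(_ i 0).
by rewrite !mxE /= -app_u => <-; rewrite mxE.
Qed.

Lemma SpMN_ur g : g \in SpMN_group -> ursubmx (glmx g) = 0.
Proof.
move=> /SpMNP[_ _ gN]; apply/matrixP=> i j.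
have : v j \in Nspace by rewrite memv_span // map_f ?mem_enum.
move/gN; rewrite mem_Nspace => /eqP/matrixP/(_ i 0).
by rewrite !mxE /= -app_v => <-; rewrite mxE.
Qed.

Lemma SpMN_sub : SpMN_group \subset SpM_group.
Proof. by apply/subsetP=> g /SpMNP[Sg gM _]; apply/SpMP. Qed.

Lemma SpM_pt_sub : SpM_pt_group \subset SpM_group.
Proof. by apply/subsetP=> g /SpM_ptP[Sg gM]; apply/SpMP; split=> // x Mx; rewrite gM. Qed.

Lemma SpM_norm : SpM_group \subset 'N(SpM_pt_group).
Proof.
apply/subsetP=> g gM; rewrite inE; apply/subsetP=> _ /imsetP[s /SpM_ptP[Ss sM] ->].
have [Sg gMM] := SpMP _ gM.
apply/SpM_ptP; split=> [|x Mx]; first by rewrite groupJ.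
by rewrite conjgE !appM sM ?appK //; apply: gMM.
Qed.

Lemma SpM_TI : (SpM_pt_group :&: SpMN_group = 1)%g.
Proof.
apply/trivgP/subsetP=> g /setIP[gpt gMN]; rewrite inE.
have [_ gM] := SpM_ptP _ gpt; have [_ _ gN] := SpMNP _ gMN.
have gid x : x \in Nspace -> app g x = x.
  move=> Nx; have := SpM_ptB x gpt; rewrite mem_Mspace => /eqP d0.
  have : app g x - x \in Nspace by rewrite memvB // gN.
  rewrite mem_Nspace => /eqP u0; apply/eqP; rewrite -subr_eq0 -[_ - _]vsubmxK.
  by rewrite d0 u0 col_mx0.
apply/eqP/val_inj; change (glmx g = 1%:M); apply/matrixP=> i j.
rewrite [RHS]mxE; case: (split_ordP j) => k ->.
  by rewrite -app_u gM ?Mspace_u // mxE eqxx andbT.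
by rewrite -app_v gid ?mxE ?eqxx ?andbT // memv_span // map_f ?mem_enum.
Qed.

Lemma block_SpMN (P D : 'M[K]_n.+1) : P^T *m D = 1%:M ->
  exists2 a, a \in SpMN_group & glmx a = block_mx P 0 0 D.
Proof.
move=> PD; pose A := block_mx P 0 0 D.
have [uPt uD] := mulmx1_unit PD.
have uP : P \in unitmx by rewrite -unitmx_tr.
have uA : A \in unitmx.
  suff /mulmx1_unit[] : A *m block_mx (invmx P) 0 0 (invmx D) = 1%:M by [].
  rewrite mulmx_block !mulmx0 !mul0mx !addr0 !add0r !mulmxV //.
  by rewrite -scalar_mx_block.
exists (FinRing.Unit (uA : A \is a GRing.unit)) => //.
set a := FinRing.Unit _.
have aE x : app a x = col_mx (P *m usubmx x) (D *m dsubmx x).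
  rewrite /app -[in LHS](vsubmxK x) (_ : glmx a = A) // mul_block_col.
  by rewrite !mul0mx addr0 add0r.
apply/SpMNP; split=> [|x|x].
- apply/SpP=> x y; rewrite !formE !aE !col_mxKu !col_mxKd !trmx_mul !mulmxA.
  rewrite -(mulmxA _ P^T) PD -(mulmxA _ D^T).
  have -> : D^T *m P = 1%:M by rewrite -[P]trmxK -trmx_mul PD trmx1.
  by rewrite !mulmx1.
- by rewrite !mem_Mspace aE col_mxKd => /eqP ->; rewrite mulmx0.
- by rewrite !mem_Nspace aE col_mxKu => /eqP ->; rewrite mulmx0.
Qed.

Lemma SpM_levi g : g \in SpM_group ->
  exists2 a, a \in SpMN_group & {in Mspace, forall x, app a x = app g x}.
Proof.
move=> gM; have [/SpP Sg _] := SpMP _ gM; have dl0 := SpM_dl gM.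
pose P := ulsubmx (glmx g); pose D := drsubmx (glmx g).
have PD : P^T *m D = 1%:M.
  apply/matrixP=> i j; have [uv _ _] := symplectic_basis i j.
  rewrite [RHS]mxE -uv -Sg !mxE /form; apply: eq_bigr => k _.
  rewrite !app_u !app_v !mxE; move/matrixP/(_ k i): dl0; rewrite !mxE => ->.
  by rewrite mul0r subr0.
have [a aMN aE] := block_SpMN PD; exists a => // x.
rewrite mem_Mspace => /eqP x0.
rewrite /app aE -[x]vsubmxK x0 -[glmx g]submxK dl0 !mul_block_col.
by rewrite !mulmx0 !mul0mx !addr0.
Qed.

Lemma SpM_compl :
  SpMN_group \in [complements to SpM_pt_group in SpM_group].
Proof.
apply/complP; split; first exact: SpM_TI.
apply/eqP; rewrite eqEsubset mul_subG ?SpM_pt_sub ?SpMN_sub //=.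
apply/subsetP=> g gM; have [a aMN aE] := SpM_levi gM.
apply/mulsgP; exists (g * a^-1)%g a; rewrite ?mulgKV //.
have Sa := subsetP SpMN_sub a aMN.
have [Sg _] := SpMP _ gM; have [Sa' _] := SpMP _ Sa.
apply/SpM_ptP; split=> [|x Mx]; first by rewrite groupM ?groupV.
have [|_ aVM] := SpMP a^-1%g _; first by rewrite groupV.
by rewrite appM -aE ?appVK //; apply: aVM.
Qed.

Lemma SpM_pt_normal : SpM_pt_group <| SpM_group.
Proof. by rewrite /normal SpM_pt_sub SpM_norm. Qed.

Lemma SpM_sdprod : (SpM_pt_group ><| SpMN_group = SpM_group)%g.
Proof.
by apply/(sdprod_normal_complP SpM_pt_normal); rewrite complgC SpM_compl.
Qed.

Lemma T_group_set : group_set T_set.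
Proof.
have TP g : reflect (g \in SpMN_group /\ forall k j : 'I_n.+1, (j <= k)%N ->
     ulsubmx (glmx g) k j = (k == j)%:R) (g \in T_set).
  rewrite [_ \in T_set]in_set; apply: (iffP andP) => -[gMN H]; split=> //.
    by move=> k j jk; have /forallP/(_ k)/forallP/(_ j)/implyP/(_ jk)/eqP := H.
  by apply/forallP=> k; apply/forallP=> j; apply/implyP=> jk; rewrite H.
apply/group_setP; split=> [|g h /TP[gMN gU] /TP[hMN hU]]; apply/TP.
  by split=> // k j _; rewrite [glmx _](_ : _ = 1%:M) // !mxE eq_lshift.
split=> [|k j jk]; first by rewrite groupM.
have -> : ulsubmx (glmx (g * h)) = ulsubmx (glmx g) *m ulsubmx (glmx h).
  rewrite [glmx (g * h)](_ : _ = glmx g *m glmx h) //.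
  rewrite -[glmx g in LHS]submxK -[glmx h in LHS]submxK mulmx_block block_mxKul.
  by rewrite (SpM_dl (subsetP SpMN_sub h hMN)) mulmx0 addr0.
rewrite mxE (bigD1 k) //= big1 ?addr0 => [|l lk].
  by rewrite gU // eqxx mul1r hU.
have [kl|kl] := leqP l k.
  by rewrite gU // eq_sym (negbTE lk) mul0r.
rewrite (hU l j) ?(leq_trans jk (ltnW kl)) //.
suff -> : (l == j) = false by rewrite mulr0.
by apply/eqP=> lj; rewrite lj ltnNge jk in kl.
Qed.
Canonical T_group := Group T_group_set.

Lemma T_subMN : T_group \subset SpMN_group.
Proof. by apply/subsetP=> g; rewrite [_ \in T_set]in_set => /andP[]. Qed.

Lemma U_group_set : group_set U_set.
Proof.
apply/comm_group_setP; apply: normC.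
by apply: subset_trans SpM_norm; apply: subset_trans T_subMN SpMN_sub.
Qed.
Canonical U_group := Group U_group_set.

Lemma U_subM : U_group \subset SpM_group.
Proof.
by rewrite mul_subG ?SpM_pt_sub // (subset_trans T_subMN SpMN_sub).
Qed.

Definition Uw_group (w : gT) : {group gT} := (U_group :^ w :&: U_group)%G.

Lemma Uw_subU w : Uw_group w \subset U_group.
Proof. exact: subsetIr. Qed.

(* i -> n -> n-1 -> ... -> i+1 -> i *)
Definition cyc (i j : 'I_n.+1) : 'I_n.+1 :=
  if j == i then ord_max else if (i < j)%N then inord j.-1 else j.

Lemma cyc_inj i : injective (cyc i).
Proof.
have cE j : cyc i j =
    (if j == i :> nat then n else if i < j then j.-1 else j)%N :> nat.
  rewrite /cyc -val_eqE /=; case: eqP => // _; case: ifP => // _.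
  by rewrite inordK // (leq_ltn_trans (leq_pred j)).
move=> j k /(congr1 (@nat_of_ord _)); rewrite !cE.
have := ltn_ord j; have := ltn_ord k; move=> kn jn E; apply: val_inj => /=.
by move: E; do 2 case: eqP => ?; do ?case: ltnP => ?; lia.
Qed.

Lemma w_exists i : exists w, [/\ w \in Sp_group,
  forall j, app w (u j) = u (cyc i j) & forall j, app w (v j) = v (cyc i j)].
Proof.
pose P : 'M[K]_n.+1 := \matrix_(k, j) (k == cyc i j)%:R.
have PP : P^T *m P = 1%:M.
  apply/matrixP=> j k; rewrite !mxE (bigD1 (cyc i j)) //= big1 ?addr0 => [|l lj].
    by rewrite !mxE eqxx mul1r (inj_eq (@cyc_inj i)).
  by rewrite !mxE (negbTE lj) mul0r.
have [w /SpMNP[Sw _ _] wE] := block_SpMN PP; exists w.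
split=> // j; apply/matrixP=> a b; rewrite ord1 ?app_u ?app_v wE;
  case: (split_ordP a) => k ->.
- by rewrite block_mxEul !mxE eq_lshift andbT.
- by rewrite block_mxEdl !mxE eq_rlshift.
- by rewrite block_mxEur !mxE eq_lrshift.
- by rewrite block_mxEdr !mxE eq_rshift andbT.
Qed.

Section Weil.

Variable F : fieldType.

Record addchar := AddChar {
  addchar_fun :> K -> F;
  addchar0 : addchar_fun 0 = 1;
  addcharD : {morph addchar_fun : a b / a + b >-> a * b}
}.

Variable lam : addchar.

Definition chi (x : V) (g : gT) : F := lam (form (app g x) x).

Local Notation Nt := {x : V | x \in Nspace}.
Definition Xmod := {ffun {x : V | x \in Nspace} -> F^o}.
HB.instance Definition _ := Vector.on Xmod.

Definition E (x : V) : Xmod := [ffun y => (val y == x)%:R].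

(* The Sp_{M,N}-component a of g = s a in Sp_M. *)
Definition levi (g : gT) : gT := remgr SpM_pt_set SpMN_set g.

Definition Xact_fun (g : gT) (f : Xmod) : Xmod :=
  \sum_(y : {x : V | x \in Nspace})
    (f y : F) *: (lam (form (app g (val y)) (app (levi g) (val y)))
                  *: E (app (levi g) (val y))).

Lemma Xact_linear g : linear (Xact_fun g).
Proof.
move=> c f h; rewrite /Xact_fun scaler_sumr -big_split; apply: eq_bigr => y _ /=.
have -> : (c *: f + h) y = c * f y + h y :> F by rewrite !ffunE.
by rewrite scalerDl; congr (_ + _); rewrite [RHS]scalerA.
Qed.
HB.instance Definition _ g :=
  GRing.isLinear.Build F Xmod Xmod *:%R (Xact_fun g) (@Xact_linear g).

Definition Xact (g : gT) : 'End(Xmod) := linfun (Xact_fun g).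

Lemma Xact_E g x : x \in Nspace -> Xact g (E x) =
  lam (form (app g x) (app (levi g) x)) *: E (app (levi g) x).
Proof.
move=> Nx; rewrite lfunE /= /Xact_fun (bigD1 (exist _ x Nx)) //= big1 ?addr0.
  by rewrite ffunE eqxx scale1r.
move=> y yx; rewrite ffunE.
suff -> : (val y == x) = false by rewrite scale0r.
by apply: contraNF yx => /eqP yx; apply/eqP/val_inj.
Qed.

Lemma Xact_sa s a x : s \in SpM_pt_group -> a \in SpMN_group -> x \in Nspace ->
  Xact (s * a) (E x) = lam (form (app (s * a) x) (app a x)) *: E (app a x).
Proof.
by move=> ss aa Nx; rewrite Xact_E // /levi (remgrMid SpM_TI).
Qed.

Lemma E_span (f : Xmod) : f = \sum_(y : Nt) (f y : F) *: E (val y).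
Proof.
apply/ffunP=> y; rewrite sum_ffunE (bigD1 y) //= big1 ?addr0 => [|z zy].
  by rewrite !ffunE eqxx [_ *: _]mulr1.
by rewrite !ffunE (inj_eq val_inj) eq_sym (negbTE zy) scaler0.
Qed.

Lemma lfun_E (f h : 'End(Xmod)) :
  (forall x, x \in Nspace -> f (E x) = h (E x)) -> f = h.
Proof.
move=> fh; apply/lfunP=> x; rewrite (E_span x) !linear_sum; apply: eq_bigr => y _.
by rewrite !linearZ /= fh // (valP y).
Qed.

Lemma leviP g : g \in SpM_group ->
  levi g \in SpMN_group /\ (g * (levi g)^-1)%g \in SpM_pt_group.
Proof.
have [_ <-] := complP SpM_compl => gM.
by split; [exact: mem_remgr | exact: (mem_divgr gM)].
Qed.

Lemma Xact_action : lmod_action SpM_group Xact.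
Proof.
have leviM : {in SpM_group &, {morph levi : g h / (g * h)%g}}.
  exact: (remgrM SpM_compl SpM_pt_normal).
have levi1 : levi 1%g = 1%g by rewrite /levi (remgr_id SpM_TI) ?group1.
split=> [|g h gM hM]; apply: lfun_E => x Nx.
  by rewrite Xact_E // levi1 id_lfunE !app1 form_alt addchar0 scale1r.
have [ag sg] := leviP gM; have [ah sh] := leviP hM.
have [_ aM _] := SpMNP _ ag; have [/SpP aS _ _] := SpMNP _ ag.
have [_ _ bN] := SpMNP _ ah.
have [_ sM] := SpM_ptP _ sg.
rewrite comp_lfunE Xact_E // leviM // Xact_E // linearZ /= Xact_E ?bN //.
rewrite scalerA -addcharD !appM; congr (lam _ *: _).
set y := app (levi h) x; set a := levi g in aS aM sM *.
pose m := app h x - y.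
have Mm : m \in Mspace.
  by have := SpM_ptB y sh; rewrite appM {1}/y appK.
have -> : app h x = y + m by rewrite addrC subrK.
move: m Mm => m Mm.
have gm : app g m = app a m.
  by rewrite -(sM (app a m) (aM _ Mm)) appM appK.
rewrite [app g _]mulmxDr -/(app g y) -/(app g m) !formDl gm aS.
by rewrite form_alt add0r addrC.
Qed.

Definition X_lmod : lmodule Xmod SpM_group := LModule Xact_action.
Definition X_U : lmodule Xmod U_group := restr_lmod X_lmod U_subM.
Definition X_Uw (w : gT) : lmodule Xmod (Uw_group w) :=
  restr_lmod X_U (Uw_subU w).

(* eps = true is the sign +, eps = false the sign -. *)
Definition Epm (eps : bool) (x : V) : Xmod :=
  if 2%N \in [pchar K] then E x
  else if eps then E x + E (- x) else E x - E (- x).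

Definition Xpm (eps : bool) : {vspace Xmod} :=
  <<[seq Epm eps x | x in [pred x : V | (x \in Nspace) && (x != 0%R)]]>>%VS.

Definition Xpm_sub (eps : bool) (alpha : K) (i : 'I_n.+1) : {vspace Xmod} :=
  <<[seq Epm eps (alpha *: v i + \sum_(j < n.+1 | (i < j)%N) c j *: v j)
    | c : {ffun 'I_n.+1 -> K}]>>%VS.

End Weil.

End Symplectic.

(* Main.v *)
Require Import Defs.
From HB Require Import structures.
From mathcomp Require Import all_boot all_order all_fingroup all_algebra.
From mathcomp Require Import all_solvable all_field mxrepresentation.
From mathcomp Require Import zify ring.

(** Let [A] be the set of vectors [alpha v_i + sum_(j > i) c_j v_j] of [N], the
indices of the spanning vectors of [X^+-_(alpha, i)]. The proof shows that [U]
permutes the lines of the [E^+-_x], [x] in [A], transitively, and that the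
normal subgroup [Sp^M] of [U] acts on them by pairwise distinct characters.

Every [g] in [U] has a Levi component [levi g] in [T], and [g] maps [E^+-_x] to
a multiple of [E^+-_(levi g x)]. As [T] is lower unitriangular on [N] it preserves
[A] ([levi_slice]), and it is transitive there because any vector of [A] can be
made column [i] of such a matrix, up to the factor [alpha] ([slice_trans]).
Since [A] does not meet [-A] in odd characteristic, the [E^+-_x] are linearly
independent, so that [X^+-_(alpha, i)] has dimension [#|A|], a power of [q].

The subgroup [U_w^+] is the stabilizer of [alpha v_i] in [U] for this action
([Uw_groupP]): conjugation by [w] moves index [i] to the end of the basis and
keeps the order of the rest, so that lying in [w^-1 U w] as well forces row [i]
of the matrix on [M] to be trivial, which dually says that [v_i] is fixed. So
[U_w^+] acts on the line of [E^+-_(alpha v_i)] by [chi_(alpha v_i)], the cosets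
of [U_w^+] inject into [A], and [X^+-_(alpha, i)] is induced from this
line ([sub_repr_ind_rsim]). The character does not depend on the sign, hence
neither does the induced module.

For irreducibility, [Sp^M] is contained in [U_w^+] and acts on [E^+-_x] by
[s |-> lam (<s x, x>)], which is [lam] of the value at [x] of a quadratic form
given by an arbitrary symmetric matrix. Distinct vectors of [A] share their
nonzero coordinate [i] and are separated by these forms ([SpM_pt_sep]). So
[U_w^+] is the inertia group of the restriction of [chi_(alpha v_i)] to [Sp^M],
and the induced representation is absolutely irreducible ([ind_lin_abs_irr]),
the projectors onto the lines and the permutation of the lines
generating the whole matrix algebra. *)

Set Implicit Arguments.
Unset Strict Implicit.
Unset Printing Implicit Defensive.

Import GroupScope GRing.Theory.
Import Defs.
Local Open Scope ring_scope.

(** * Monomial and induced matrix representations *)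

Section MatrixRepresentations.

Variables (F : fieldType) (gT : finGroupType) (G : {group gT}).

(** The operators [rG g - r 0 j], one for each [j <> i], lie in the enveloping
algebra and are diagonal; their product kills every coordinate except [i], as
in Lagrange interpolation. *)
Lemma envelop_diag_delta d (rG : mx_representation F G d) (i : 'I_d) :
    (forall j, i != j -> exists2 g, g \in G &
       exists2 r, rG g = diag_mx r & r 0 i != r 0 j) ->
  (delta_mx i i \in enveloping_algebra_mx rG)%MS.
Proof.
move=> sep.
suff [r [Er ri rj]] : exists r, [/\ (diag_mx r \in enveloping_algebra_mx rG)%MS,
    r 0 i != 0 & forall j, j \in enum (predC1 i) -> r 0 j = 0].
  have -> : delta_mx i i = (r 0 i)^-1 *: diag_mx r.
    apply/matrixP=> a b; rewrite !mxE.
    have [->|ai] := eqVneq a i; last first.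
      by rewrite (rj a) ?mem_enum ?inE // mul0rn mulr0.
    by rewrite eq_sym; case: eqP => _; rewrite ?mulr0 // mulVf.
  by rewrite linearZ scalemx_sub.
have : i \notin enum (predC1 i) by rewrite mem_enum !inE eqxx.
elim: (enum _) => [_|j s IHs].
  exists (const_mx 1); split=> //; first by rewrite diag_const_mx envelop_mx1.
  by rewrite mxE oner_neq0.
rewrite inE negb_or => /andP[ij /IHs[r [Er ri rs]]].
have [g Gg [t gt tij]] := sep j ij.
exists (\row_k (r 0 k * (t 0 k - t 0 j))); split.
- rewrite -(_ : diag_mx r *m (rG g - (t 0 j)%:M) = diag_mx _); last first.
    rewrite gt -diag_const_mx -raddfB mulmx_diag; congr diag_mx.
    by apply/rowP=> k; rewrite !mxE.
  rewrite envelop_mxM // linearB addmx_sub ?envelop_mx_id //.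
  by rewrite -scaleN1r scalemx_sub // -scalemx1 linearZ scalemx_sub ?envelop_mx1.
- by rewrite mxE mulf_neq0 // subr_eq0.
move=> k; rewrite inE mxE => /orP[/eqP->|/rs->]; last by rewrite mul0r.
by rewrite subrr mulr0.
Qed.

(** A monomial group whose diagonal elements separate the coordinates and which
permutes the coordinate lines transitively spans all matrices: the projectors
onto the lines are in its enveloping algebra, and the transitivity carries
them to all the matrix units. *)
Lemma separated_transitive_mx_abs_irr d (rG : mx_representation F G d) :
    (0 < d)%N ->
    (forall i j, i != j -> exists2 g, g \in G &
       exists2 r, rG g = diag_mx r & r 0 i != r 0 j) ->
    (forall i j, exists2 g, g \in G &
       exists2 c, c != 0 & rG g *m delta_mx j j = c *: delta_mx i j) ->
  mx_absolutely_irreducible rG.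
Proof.
move=> d_gt0 sep trans; rewrite /mx_absolutely_irreducible d_gt0 /=.
rewrite -sub1mx; apply/row_subP=> k; rewrite rowE mulmx1.
case/mxvec_indexP: k => i j; rewrite -mxvec_delta.
have [g Gg [c c0 Eg]] := trans i j.
rewrite -(scalerK c0 (delta_mx i j)) -Eg linearZ scalemx_sub //.
rewrite envelop_mxM ?envelop_mx_id //.
by apply: envelop_diag_delta => l; apply: sep.
Qed.

(** The matrices of [sub_repr] refer to an unspecified basis of [W]; this lets
any other basis be used up to similarity. The intertwiner is the change of
basis matrix. *)
Lemma sub_repr_rsim (X : vectType F) (rho : lmodule X G) (W : {vspace X})
    (modW : submodule rho W) d (rG : mx_representation F G d)
    (b : d.-tuple X) :
    basis_of W b ->
    {in G, forall g (j : 'I_d), rho g b`_j = \sum_i rG g i j *: b`_i} ->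
  mx_rsim (sub_repr modW) rG.
Proof.
move=> basb rhob; have bW j : b`_j \in W.
  have [jd|dj] := ltnP j d; last by rewrite nth_default ?mem0v ?size_tuple.
  by apply: (basis_mem basb); rewrite mem_nth ?size_tuple.
have cb x : x \in W -> x = \sum_i coord (vbasis W) i x *: (vbasis W)`_i.
  exact: coord_vbasis.
have fW := basis_free (vbasisP W).
exists (\matrix_(k, j) coord (vbasis W) k b`_j).
- exact: size_basis basb.
- apply/row_freeP; exists (\matrix_(j, k) coord b j (vbasis W)`_k).
  apply/matrixP=> k l; rewrite !mxE.
  rewrite eq_sym -val_eqE -(coord_free _ _ fW) /=.
  have vW : (vbasis W)`_l \in W by rewrite vbasis_mem ?mem_nth ?size_tuple.
  rewrite [in RHS](coord_basis basb vW) linear_sum; apply: eq_bigr => j _.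
  by rewrite !mxE linearZ mulrC.
move=> g Gg; apply/matrixP=> k j; rewrite !mxE.
transitivity (coord (vbasis W) k (rho g b`_j)).
  rewrite [in RHS](cb _ (bW j)) !linear_sum; apply: eq_bigr => l _.
  by rewrite !mxE !linearZ /= mulrC.
rewrite rhob // linear_sum; apply: eq_bigr => l _.
by rewrite !mxE linearZ mulrC.
Qed.

Lemma sub_mx_scalar (X : vectType F) (rho : lmodule X G) (W : {vspace X}) g c :
  (forall x, x \in W -> rho g x = c *: x) -> sub_mx rho W g = c%:M.
Proof.
move=> gW; apply/matrixP=> k l; rewrite !mxE.
rewrite gW ?vbasis_mem ?mem_nth ?size_tuple // linearZ /=.
by rewrite coord_free ?(basis_free (vbasisP W)) // mulr_natr eq_sym.
Qed.

End MatrixRepresentations.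

Section InducedLinear.

Variables (F : fieldType) (gT : finGroupType) (G H : {group gT}).
Hypothesis sHG : H \subset G.
Variables (chi : gT -> F) (d : nat) (rH : mx_representation F H d).
Hypothesis d1 : d = 1%N.
Hypothesis rH_chi : {in H, forall h, rH h = (chi h)%:M}.

Local Notation t := (@lcoset_rep _ H G).
Local Notation m := (\sum_(k < #|lcosets H G|) d)%N.
(* The rows of the induced matrices are indexed by pairs (coset, row of rH); *)
(* as d = 1, such a row amounts to a coset.                                  *)
Local Notation coset_ix := (@tagnat.sig1 _ (fun _ : 'I_#|lcosets H G| => d)).

Lemma coset_ix_inj : injective coset_ix.
Proof.
move=> s s' E; rewrite -[s]tagnat.sigK -[s']tagnat.sigK; congr tagnat.rank.
move: E; rewrite /tagnat.sig1; case: (tagnat.sig s) (tagnat.sig s').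
move=> k x [k' x'] /= <-; congr existT.
by move: x x'; rewrite d1 => x x'; rewrite !ord1.
Qed.

Lemma coset_ix_surj k : exists s, coset_ix s = k.
Proof.
have z : 'I_d by rewrite d1; exact: ord0.
by exists (tagnat.Rank k z); rewrite tagnat.Rank1K.
Qed.

Lemma ind_mx_linE g s s' :
  let h := ((t (coset_ix s))^-1 * g * t (coset_ix s'))%g in
  ind_mx G rH g s s' = if h \in H then chi h else 0.
Proof.
rewrite /= mxE /ind_block; case: ifP => Hh; last by rewrite mxE.
rewrite rH_chi // mxE.
move: (tagnat.sig2 s) (tagnat.sig2 s') => x x'.
suff -> : x = x' by rewrite eqxx.
by clear -d1; move: x x'; rewrite d1 => x x'; rewrite !ord1.
Qed.

Lemma lin_char1 : chi 1%g = 1.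
Proof.
have := repr_mx1 rH; rewrite rH_chi // => /matrixP/(_ (cast_ord (esym d1) 0)).
by move/(_ (cast_ord (esym d1) 0)); rewrite !mxE eqxx.
Qed.

Lemma mem_coset_ix g : g \in G -> exists s, ((t (coset_ix s))^-1 * g)%g \in H.
Proof.
move=> Gg; have cg : (g *: H)%g \in lcosets H G by apply/lcosetsP; exists g.
have [s Es] := coset_ix_surj (enum_rank_in cg (g *: H)%g); exists s.
rewrite -mem_lcoset -(proj2 (lcoset_repP sHG _)) Es enum_rankK_in //.
exact: lcoset_refl.
Qed.

Lemma coset_ix_eq g s s' : ((t (coset_ix s))^-1 * g)%g \in H ->
  (((t (coset_ix s'))^-1 * g)%g \in H) = (s' == s).
Proof.
move=> Hs; rewrite -(inj_eq coset_ix_inj) -(lcoset_rep_inj sHG).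
by rewrite -[RHS](groupMr _ Hs) mulgA mulgK.
Qed.

(** If [W] is generated as a module by a vector [e] on which [H] acts through
[chi], then the translates of [e] by coset representatives of [H] span [W];
if there are at most [\dim W] of them they form a basis, in which the matrices
of [W] are those of the induced representation. *)
Lemma sub_repr_ind_rsim (X : vectType F) (rho : lmodule X G) (e : X)
    (W : {vspace X}) (modW : submodule rho W) :
    {in H, forall h, rho h e = chi h *: e} ->
    (W <= <<[seq rho g e | g in G]>>)%VS ->
    (#|lcosets H G| <= \dim W)%N ->
  mx_rsim (sub_repr modW) (ind_repr rH sHG).
Proof.
move=> He genW dimW; have [rho1 rhoM] := lmod_funP rho.
pose b := [tuple rho (t (coset_ix s)) e | s < m].
have bE (s : 'I_m) : b`_s = rho (t (coset_ix s)) e.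
  by rewrite -[RHS](tnth_mktuple (fun s => rho (t (coset_ix s)) e)) (tnth_nth 0).
have tG k : t k \in G := proj1 (lcoset_repP sHG k).
have rhoE g (s : 'I_m) : g \in G -> ((t (coset_ix s))^-1 * g)%g \in H ->
    rho g e = chi ((t (coset_ix s))^-1 * g)%g *: b`_s.
  move=> Gg Hg; rewrite -{1}[g](mulKVg (t (coset_ix s))) rhoM ?(subsetP sHG _ Hg) //.
  by rewrite comp_lfunE He // linearZ bE.
apply: (@sub_repr_rsim _ _ _ _ _ _ _ _ _ b).
  have mE : m = #|lcosets H G| by rewrite sum_nat_const card_ord d1 muln1.
  rewrite basisEdim size_tuple [X in (X <= \dim W)%N]mE dimW andbT.
  apply: subv_trans genW _; apply/span_subvP=> _ /imageP[g Gg ->].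
  have [s Hs] := mem_coset_ix Gg.
  by rewrite (rhoE g s) // memvZ // memv_span // mem_nth ?size_tuple.
move=> g Gg s'; rewrite bE -comp_lfunE -rhoM //.
have Ggt : (g * t (coset_ix s'))%g \in G by rewrite groupM.
have [s Hs] := mem_coset_ix Ggt; rewrite (rhoE _ s) //.
rewrite [RHS](bigD1 s) //= [X in _ + X]big1 ?addr0 => [|s'' ss].
  by rewrite ind_mx_linE -mulgA Hs.
by rewrite ind_mx_linE -mulgA (coset_ix_eq _ Hs) (negbTE ss) scale0r.
Qed.

(** A form of Mackey's criterion: on a normal subgroup [S] of [G] contained in
[H] the induced representation is diagonal, with the conjugates of [chi] on the
diagonal. When [H] is the inertia group of the restriction of [chi] to [S]
these conjugates are pairwise distinct, and [G] permutes them transitively. *)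
Lemma ind_lin_abs_irr (S : {group gT}) :
    S \subset H -> G \subset 'N(S) ->
    {in G, forall g, g \notin H -> exists2 s, s \in S & chi (s ^ g) != chi s} ->
  mx_absolutely_irreducible (ind_repr rH sHG).
Proof.
move=> sSH nSG inert; have tG k : t k \in G := proj1 (lcoset_repP sHG k).
have SJ s g : s \in S -> g \in G -> (s ^ g)%g \in S.
  by move=> Ss Gg; rewrite memJ_norm // (subsetP nSG).
apply: separated_transitive_mx_abs_irr => [|i j ij|i j].
- rewrite sum_nat_const card_ord d1 muln1.
  apply/card_gt0P; exists (H : {set gT}); apply/lcosetsP.
  by exists 1%g; rewrite ?lcoset1.
- set ti := t (coset_ix i); set tj := t (coset_ix j).
  have Hij : (ti^-1 * tj)%g \notin H.
    by rewrite lcoset_rep_inj // (inj_eq coset_ix_inj).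
  have [|s Ss chs] := inert (ti^-1 * tj)%g _ Hij.
    by rewrite groupM ?groupV ?tG.
  have Ss' : (s ^ ti^-1)%g \in S by rewrite SJ ?groupV ?tG.
  exists (s ^ ti^-1)%g; first by rewrite (subsetP sHG) // (subsetP sSH).
  exists (\row_k chi ((s ^ ti^-1) ^ t (coset_ix k))).
    apply/matrixP=> k l; rewrite ind_mx_linE !mxE.
    have -> : ((t (coset_ix k))^-1 * (s ^ ti^-1) * t (coset_ix l) =
        (s ^ ti^-1) ^ t (coset_ix k) * ((t (coset_ix k))^-1 * t (coset_ix l)))%g.
      by rewrite [((s ^ _) ^ _)%g]conjgE !mulgA mulgK.
    have Hk : ((s ^ ti^-1) ^ t (coset_ix k))%g \in H.
      by rewrite (subsetP sSH) // SJ.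
    rewrite groupMl // lcoset_rep_inj // (inj_eq coset_ix_inj).
    by case: eqP => // ->; rewrite mulVg mulg1.
  by rewrite !mxE conjgKV -conjgM eq_sym.
exists (t (coset_ix i) * (t (coset_ix j))^-1)%g.
  by rewrite groupM ?groupV ?tG.
exists 1; first exact: oner_neq0.
rewrite scale1r; apply/matrixP=> k l.
rewrite mxE [LHS](bigD1 j) //= [X in _ + X]big1 ?addr0 => [|a aj]; last first.
  by rewrite [delta_mx j j a l]mxE (negbTE aj) mulr0.
rewrite ind_mx_linE mulgA mulgKV.
rewrite lcoset_rep_inj // (inj_eq coset_ix_inj) !mxE eqxx.
case: eqP => [->|_]; last by rewrite mul0r.
by rewrite mulVg lin_char1 mul1r.
Qed.

End InducedLinear.

(** * The groups [U] and [U_w] and their Levi components *)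

Section SymplecticGroups.

Variables (K : finFieldType) (n : nat).

Local Notation V := 'cV[K]_(n.+1 + n.+1).
Local Notation gT := {'GL_(n.+1 + n.+1)[K]}.
Local Notation u := (u K).
Local Notation v := (v K).

Implicit Types (g s t w : gT) (x y : V) (i j k l : 'I_n.+1).

Lemma formC x y : form x y = - form y x.
Proof.
by rewrite /form -sumrN; apply: eq_bigr => k _; rewrite opprB ![_ * y _ _]mulrC.
Qed.

Lemma formDr x y z : form x (y + z) = form x y + form x z.
Proof. by rewrite formC formDl opprD -!formC. Qed.

Lemma formNl x y : form (- x) y = - form x y.
Proof.
by apply/eqP; rewrite -addr_eq0 -formDl addNr -[0](subrr 0) formC formBr subrr oppr0.
Qed.

Lemma formNr x y : form x (- y) = - form x y.
Proof. by rewrite formC formNl -formC. Qed.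

Lemma Nspace_ext x y : x \in Nspace K n -> y \in Nspace K n ->
  (forall j, form (u j) x = form (u j) y) -> x = y.
Proof.
rewrite !mem_Nspace => /eqP x0 /eqP y0 xy; rewrite -[x]vsubmxK -[y]vsubmxK x0 y0.
by congr col_mx; apply/matrixP=> j z; rewrite ord1 !mxE -!form_u.
Qed.

Lemma Nspace_v j : v j \in Nspace K n.
Proof. by rewrite memv_span // map_f ?mem_enum. Qed.

Lemma appD g x y : app g (x + y) = app g x + app g y. Proof. exact: mulmxDr. Qed.
Lemma appN g x : app g (- x) = - app g x. Proof. exact: mulmxN. Qed.
Lemma appZ g c x : app g (c *: x) = c *: app g x.
Proof. by rewrite /app scalemxAr. Qed.

Lemma SpM_Sp g : g \in SpM_group K n ->
  forall x y, form (app g x) (app g y) = form x y.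
Proof. by case/SpMP=> /SpP. Qed.

Lemma leviM : {in SpM_group K n &, {morph levi (n:=n) : g h / (g * h)%g}}.
Proof. exact: (remgrM (SpM_compl K n) (SpM_pt_normal K n)). Qed.

Lemma levi_id g : g \in SpMN_group K n -> levi g = g.
Proof. by move=> gMN; rewrite /levi (remgr_id (SpM_TI K n)). Qed.

Lemma levi_SpM g : g \in SpM_group K n -> levi g \in SpM_group K n.
Proof. by case/leviP=> /(subsetP (SpMN_sub K n)). Qed.

Lemma levi_M g x : g \in SpM_group K n -> x \in Mspace K n ->
  app (levi g) x = app g x.
Proof.
move=> gM Mx; have [aMN /SpM_ptP[_ sM]] := leviP gM.
by rewrite -(sM (app (levi g) x)) ?appM ?appK //; case/SpMNP: aMN => _ /(_ x Mx).
Qed.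

Lemma levi_N g x : g \in SpM_group K n -> x \in Nspace K n ->
  app (levi g) x \in Nspace K n.
Proof. by case/leviP=> /SpMNP[_ _ gN] _; apply: gN. Qed.

Lemma levi_pt s : s \in SpM_pt_group K n -> levi s = 1%g.
Proof.
move=> spt; have [aMN sa] := leviP (subsetP (SpM_pt_sub K n) s spt).
apply/set1P; rewrite -[[set 1%g]](SpM_TI K n) inE aMN andbT.
by rewrite -groupV -(groupMl _ spt).
Qed.

Lemma app_levi_M g x : g \in SpM_group K n -> app g x - app (levi g) x \in Mspace K n.
Proof.
move=> gM; have [_ sa] := leviP gM.
by have := SpM_ptB (app (levi g) x) sa; rewrite appM appK.
Qed.

(** The matrix of [g] on [M] relative to the [u j]: for [g] preserving [M],
column [j] holds the coordinates of [app g (u j)]. *)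
Definition matM g k j : K := glmx g (lshift n.+1 k) (lshift n.+1 j).

Lemma matME g k j : matM g k j = form (app g (u j)) (v k).
Proof. by rewrite formC form_v opprK app_u. Qed.

(** An element of [Sp_M] and its Levi component have the same matrix on [M], so
membership in [U = T Sp^M] can be read off that matrix. *)
Lemma U_groupP g : reflect (g \in SpM_group K n /\
    forall k j, (j <= k)%N -> matM g k j = (k == j)%:R) (g \in U_group K n).
Proof.
have matM_levi h k j : h \in SpM_group K n -> matM (levi h) k j = matM h k j.
  by move=> hM; rewrite !matME levi_M ?Mspace_u.
have unitriP h : reflect (forall k j, (j <= k)%N -> matM h k j = (k == j)%:R)
    (upper_unitriangular (ulsubmx (glmx h))).
  apply: (iffP forallP) => [H k j jk|H k].
    by have /forallP/(_ j)/implyP/(_ jk)/eqP := H k; rewrite !mxE.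
  by apply/forallP=> j; apply/implyP=> jk; rewrite !mxE -H.
apply: (iffP idP) => [Ug|[gM gU]].
  split; first exact: (subsetP (U_subM K n)).
  case/mulsgP: Ug => t s; rewrite [_ \in _]inE => /andP[_ /unitriP tU].
  case/SpM_ptP=> _ sM -> k j jk; rewrite -tU // !matME appM sM ?Mspace_u //.
have [aMN _] := leviP gM.
have aS := levi_SpM gM; have [/SpP Sa aM] := SpMP _ aS.
apply/mulsgP; exists (levi g) ((levi g)^-1 * g)%g; rewrite ?mulKVg //.
  rewrite [_ \in _]inE aMN /=; apply/unitriP=> k j jk.
  by rewrite matM_levi //; exact: gU.
apply/SpM_ptP; split; last by move=> x Mx; rewrite appM -(levi_M gM Mx) appK.
have [] := SpMP _ gM; have [] := SpMP _ aS => Sa1 _ Sg _.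
by rewrite groupM ?groupV.
Qed.

(** The entry [matM g i j] is the pairing of [app (levi g) (u j)] with [v i].
As [levi g] preserves the form, row [i] being trivial means that the pairings
of [v i] with the [u j] do not change when [levi g] is applied to [v i]. *)
Lemma levi_fix_v g i : g \in SpM_group K n ->
  (forall j, matM g i j = (i == j)%:R) <-> app (levi g) (v i) = v i.
Proof.
move=> gM; have aM := levi_SpM gM; have [aMN _] := leviP gM.
have mE j : matM g i j = form (app (levi g) (u j)) (v i).
  by rewrite matME levi_M ?Mspace_u.
have uv j : form (u j) (v i) = (i == j)%:R.
  by have [-> _ _] := symplectic_basis K j i; rewrite eq_sym.
split=> [gi|ai j]; last by rewrite mE -{1}ai SpM_Sp // uv.
have [_ _ aVN] := SpMNP (levi g)^-1%g (groupVr aMN).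
suff {1}<- : app (levi g)^-1%g (v i) = v i by rewrite appVK.
apply: Nspace_ext => [||j]; rewrite ?aVN ?Nspace_v // uv -gi mE.
by rewrite -[in RHS](appVK (levi g) (v i)) SpM_Sp.
Qed.

Section Stabilizer.

Variables (i : 'I_n.+1) (w : gT).
Hypothesis Sw : w \in Sp_group K n.
Hypothesis wu : forall j, app w (u j) = u (cyc i j).
Hypothesis wv : forall j, app w (v j) = v (cyc i j).

Lemma cyc_val j : cyc i j =
  (if j == i :> nat then n else if i < j then j.-1 else j)%N :> nat.
Proof.
rewrite /cyc -val_eqE /=; case: eqP => // _; case: ifP => // _.
by rewrite inordK // (leq_ltn_trans (leq_pred j)).
Qed.

Lemma w_SpM : w \in SpM_group K n.
Proof.
apply/SpMP; split=> // x Mx; have [c _ cK] := injF_bij (@cyc_inj n i).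
apply: Mspace_ortho => k; rewrite -(cK k) -wu (SpP _ Sw).
by rewrite form_Mspace ?Mspace_u.
Qed.

Lemma matMJ g k j : matM (g ^ w^-1) (cyc i k) (cyc i j) = matM g k j.
Proof.
by rewrite !matME -wu -wv conjgE invgK !appM appK (SpP _ Sw).
Qed.

(** Conjugating by [w] renumbers the rows and columns of the matrix on [M] by
[cyc i], which moves [i] to the last place and keeps the order of the other
indices. So the only new condition that [w g w^-1 \in U] imposes on an element
[g] of [U] is that the entries of row [i] to the right of the diagonal vanish,
that is, that row [i] be trivial. *)
Lemma Uw_groupP g : g \in U_group K n ->
  g \in Uw_group w <-> app (levi g) (v i) = v i.
Proof.
move=> Ug; have [gM gU] := U_groupP _ Ug; rewrite inE Ug andbT mem_conjg.
rewrite -levi_fix_v //; split=> [/U_groupP[_ gwU] j|gi].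
  rewrite -matMJ gwU ?(inj_eq (@cyc_inj n i)) //.
  by rewrite (cyc_val i) eqxx -ltnS.
apply/U_groupP; split=> [|k' j']; first by rewrite groupJ ?groupV ?w_SpM.
have [c _ cK] := injF_bij (@cyc_inj n i).
rewrite -(cK k') -(cK j') matMJ (inj_eq (@cyc_inj n i)).
move: (c k') (c j') => k j.
have [->|ki] := eqVneq k i; first by rewrite gi.
move: ki; rewrite !cyc_val -val_eqE /= => ki kj; apply: gU.
have := ltn_ord j; have := ltn_ord k; move=> kn jn.
by move: kj ki; do 2 case: eqP => ?; do ?case: ltnP => ?; lia.
Qed.

End Stabilizer.

End SymplecticGroups.

(** * The vectors with first nonzero coordinate [alpha] in place [i] *)

Section Slices.

Variables (K : finFieldType) (n : nat).

Local Notation V := 'cV[K]_(n.+1 + n.+1).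
Local Notation gT := {'GL_(n.+1 + n.+1)[K]}.
Local Notation u := (u K).
Local Notation v := (v K).

Implicit Types (g s t w : gT) (x y : V) (i j k l : 'I_n.+1).

Variables (alpha : K) (i : 'I_n.+1).
Hypothesis alpha_neq0 : alpha != 0.

(** The index set of the basis of [Xpm_sub]: the vectors [x] of [N] whose first
nonzero coordinate is [alpha], in place [i]. The coordinates of [x] along the
[v j] are written [form (u j) x] so that they transform by adjunction. *)
Definition slice : {set V} :=
  [set x | [&& x \in Nspace K n, form (u i) x == alpha
             & [forall j : 'I_n.+1, (j < i)%N ==> (form (u j) x == 0)]]].

Lemma sliceP x : reflect [/\ x \in Nspace K n, form (u i) x = alpha
    & forall j, (j < i)%N -> form (u j) x = 0] (x \in slice).
Proof.
rewrite inE; apply: (iffP and3P) => -[Nx /eqP ix H]; split=> //; try exact/eqP.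
  by move=> j ji; have /forallP/(_ j)/implyP/(_ ji)/eqP := H.
by apply/forallP=> j; apply/implyP=> ji; rewrite H.
Qed.

Definition slice_vec (c : {ffun 'I_n.+1 -> K}) : V :=
  alpha *: v i + \sum_(j < n.+1 | (i < j)%N) c j *: v j.

Lemma form_sumr (I : Type) (r : seq I) (P : pred I) (f : I -> V) x :
  form x (\sum_(j <- r | P j) f j) = \sum_(j <- r | P j) form x (f j).
Proof.
elim/big_rec2: _ => [|j a b _ <-]; last by rewrite formDr.
by apply: (addrI (form x 0)); rewrite -formDr !addr0.
Qed.

Lemma form_slice_vec c k : form (u k) (slice_vec c) =
  if k == i then alpha else if (i < k)%N then c k else 0.
Proof.
have uv a j : form (u k) (a *: v j) = a *+ (k == j).
  by rewrite form_u !mxE eq_rshift andbT mulr_natr.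
rewrite formDr form_sumr uv; have [ki|ki] := eqVneq k i.
  rewrite big1 ?addr0 // => j ij; rewrite uv; case: eqP => // kj.
  by rewrite -kj ki ltnn in ij.
rewrite add0r; case: ifP => ik.
  rewrite (bigD1 k) //= uv eqxx big1 ?addr0 // => j /andP[_ jk].
  by rewrite uv eq_sym (negbTE jk).
rewrite big1 // => j ij; rewrite uv; case: eqP => // kj.
by rewrite kj ij in ik.
Qed.

Lemma slice_vec_slice c : slice_vec c \in slice.
Proof.
apply/sliceP; split=> [||j ji]; last 2 first.
- by rewrite form_slice_vec eqxx.
- by rewrite form_slice_vec -val_eqE /= ltn_eqF // ltnNge ltnW.
rewrite memvD ?memvZ ?Nspace_v //.
by apply: memv_suml => j _; rewrite memvZ ?Nspace_v.
Qed.

Lemma slice_vecP x : x \in slice -> x = slice_vec [ffun k => form (u k) x].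
Proof.
move=> Ax; have [Nx ix jx] := sliceP _ Ax.
have [Ny _ _] := sliceP _ (slice_vec_slice [ffun k => form (u k) x]).
apply: Nspace_ext => // k; rewrite form_slice_vec ffunE.
case: eqVneq => [->//|ki].
by case: ltngtP ki => [||/val_inj->] //; rewrite ?eqxx // => /jx.
Qed.

Lemma card_slice : #|slice| = (#|K| ^ (n.+1 - i.+1))%N.
Proof.
pose D := [pred j : 'I_n.+1 | (i < j)%N].
have cD : #|D| = (n.+1 - i.+1)%N.
  rewrite -sum1_card -(big_mkord (fun b => (i < b)%N) (fun=> 1%N)).
  rewrite -(big_nat_widenl _ 0 _ xpredT) //.
  by rewrite sum_nat_const_nat muln1.
rewrite -cD -(card_pffun_on 0 D K) -(card_in_imset (f := slice_vec)).
  apply: eq_card => x; apply/idP/imsetP => [Ax|[c _ ->]]; last exact: slice_vec_slice.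
  exists [ffun k : 'I_n.+1 => if (i < k)%N then form (u k) x else 0].
    apply/pffun_onP; split=> //.
    by apply/subsetP=> k; rewrite !inE ffunE; case: ifP; rewrite ?eqxx.
  rewrite [LHS]slice_vecP // /slice_vec; congr (_ + _).
  by apply: eq_bigr => j ij; rewrite !ffunE ij.
move=> c c' /pffun_onP[/subsetP sc _] /pffun_onP[/subsetP sc' _] cc.
apply/ffunP=> k; case ik : (i < k)%N.
  have := congr1 (form (u k)) cc; rewrite !form_slice_vec -val_eqE /= ik.
  by rewrite gtn_eqF.
have z (d : {ffun 'I_n.+1 -> K}) : {subset 0.-support d <= D} -> d k = 0.
  by move=> sd; apply/eqP; apply: contraFT ik => dk; apply: (sd k); rewrite inE.
by rewrite !z.
Qed.

Lemma slice_v : alpha *: v i \in slice.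
Proof.
have -> : alpha *: v i = slice_vec 0.
  by rewrite /slice_vec big1 ?addr0 // => j _; rewrite ffunE scale0r.
exact: slice_vec_slice.
Qed.

Lemma slice_neq0 x : x \in slice -> x != 0.
Proof.
case/sliceP=> _ ix _; apply: contraNneq alpha_neq0 => x0.
by rewrite -ix x0 form_u mxE.
Qed.

Lemma slice_opp x y : 2%N \notin [pchar K] -> x \in slice -> y \in slice ->
  (y == - x) = false.
Proof.
move=> K2 /sliceP[_ ix _] /sliceP[_ iy _]; apply: contraNF K2 => /eqP E.
rewrite !inE /= -(mulrI_eq0 _ (mulfI alpha_neq0)) mulr_natr mulr2n addr_eq0.
by rewrite -{1}iy E formNr ix.
Qed.

(** The coordinate of [app (levi g) x] along [v k] is the pairing of [x] with
[g^-1 (u k)], which is [u k] plus a combination of the [u l], [l < k]; for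
[k <= i] the latter are orthogonal to [x]. *)
Lemma levi_slice g x : g \in U_group K n -> x \in slice -> app (levi g) x \in slice.
Proof.
move=> Ug /sliceP[Nx ix jx].
have [gM _] := U_groupP _ Ug.
have [hM hU] := U_groupP _ (groupVr Ug).
have fE k : form (u k) (app (levi g) x) = \sum_l matM g^-1 l k * form (u l) x.
  have gV := levi_SpM gM; have gVV := groupVr gV.
  rewrite -(SpM_Sp gVV) appK.
  have -> : (levi g)^-1%g = levi g^-1.
    by apply/eqP; rewrite eq_invg_mul -leviM ?groupV // mulgV levi_pt ?group1.
  rewrite levi_M ?Mspace_u // formC {1}/form -sumrN; apply: eq_bigr => l _.
  have -> : app g^-1 (u k) (rshift n.+1 l) 0 = 0.
    by rewrite app_u; have /matrixP/(_ l k) := SpM_dl hM; rewrite !mxE.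
  by rewrite app_u mulr0 sub0r opprK mulrC form_u.
apply/sliceP; split=> [||j ji]; first exact: levi_N.
- rewrite fE (bigD1 i) //= hU // eqxx mul1r ix big1 ?addr0 // => l li.
  have [il|li'] := leqP i l; first by rewrite hU // (negbTE li) mul0r.
  by rewrite jx ?mulr0.
rewrite fE big1 // => l _; have [jl|lj] := leqP j l.
  rewrite hU //; case: eqP => [->|_]; last by rewrite mul0r.
  by rewrite jx // mulr0.
by rewrite jx ?mulr0 // (ltn_trans lj).
Qed.

Lemma T_subU : T_group K n \subset U_group K n.
Proof. exact: mulG_subl. Qed.

(** The matrix [D] on [N] replaces [v i] by [alpha^-1 *: x] and fixes the other
[v j]; it is a transvection, so its inverse transpose [P] on [M] is explicit. *)
Lemma slice_trans x : x \in slice ->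
  exists2 t, t \in T_group K n & app t (alpha *: v i) = x.
Proof.
move=> /sliceP[Nx ix jx].
pose c : 'cV[K]_n.+1 := alpha^-1 *: dsubmx x - delta_mx i 0.
have c0 j : (j <= i)%N -> c j 0 = 0.
  move=> ji; rewrite !mxE -form_u; have [->|nji] := eqVneq j i.
    by rewrite ix mulVf // subrr.
  by rewrite jx ?mulr0 ?subr0 // ltn_neqAle nji.
pose D := 1%:M + c *m delta_mx 0 i; pose P := 1%:M - (delta_mx i 0 : 'cV_ _) *m c^T.
have PD : P^T *m D = 1%:M.
  rewrite linearB /= trmx1 trmx_mul trmxK trmx_delta mulmxBl mul1mx mulmxDr mulmx1.
  rewrite mulmxA -(mulmxA c) -rowE (_ : row i c = 0) ?mulmx0 ?mul0mx ?addr0 ?addrK //.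
  by apply/matrixP=> a b; rewrite !ord1 mxE c0 // mxE.
have [t tMN tE] := block_SpMN PD; exists t.
  rewrite [_ \in _]inE tMN /=; apply/forallP=> k; apply/forallP=> j.
  apply/implyP=> jk; rewrite tE block_mxKul; have [ki|ki] := eqVneq k i.
    by rewrite !mxE big_ord1 [c^T _ _]mxE c0 -?ki // mulr0 subr0.
  by rewrite !mxE big_ord1 mxE (negbTE ki) mul0r subr0.
rewrite /app tE -[RHS]vsubmxK.
rewrite -[_ *: v i]vsubmxK mul_block_col !mul0mx add0r addr0.
move: (Nx) (Nspace_v K i); rewrite !mem_Nspace => /eqP-> /eqP vi.
rewrite linearZ /= vi scaler0 mulmx0; congr col_mx.
have -> : dsubmx (alpha *: v i) = alpha *: delta_mx i 0.
  by apply/matrixP=> a b; rewrite !mxE eq_rshift.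
rewrite -scalemxAr mulmxDl mul1mx -mulmxA mul_delta_mx.
rewrite (_ : delta_mx 0 0 = 1%:M) ?mulmx1; last first.
  by apply/matrixP=> a b; rewrite !ord1 !mxE.
by rewrite addrC subrK scalerA mulfV // scale1r.
Qed.

End Slices.

(** * Characters of the pointwise stabilizer of [M] *)

Section Separation.

Variables (K : finFieldType) (n : nat).

Local Notation V := 'cV[K]_(n.+1 + n.+1).
Local Notation u := (u K).
Local Notation v := (v K).

Lemma quad_delta (d : 'cV[K]_n.+1) k l :
  (d^T *m delta_mx k l *m d) 0 0 = d k 0 * d l 0.
Proof.
by rewrite -(mul_delta_mx (0 : 'I_1)) mulmxA -colE -mulmxA -rowE mxE big_ord1 !mxE.
Qed.

(** Symmetric matrices give the diagonal forms [x_j ^ 2] and the forms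
[2 x_i x_j]. In characteristic 2 the squares separate coordinates since
squaring is injective; in odd characteristic they do so up to sign, and the
forms [2 x_i x_j] settle the sign thanks to the common nonzero coordinate
[i]. The proof combines both without distinguishing the characteristic. *)
Lemma symmetric_quad_sep (d e : 'cV[K]_n.+1) i :
    d i 0 = e i 0 -> d i 0 != 0 -> d != e ->
  exists2 S : 'M[K]_n.+1, S^T = S &
    (d^T *m S *m d) 0 0 != (e^T *m S *m e) 0 0.
Proof.
move=> dei di0 de.
have [j dej] : exists j, d j 0 != e j 0.
  apply/existsP; apply: contraNT de; rewrite negb_exists => /forallP H.
  by apply/eqP/colP=> j; apply/eqP; rewrite -[_ == _]negbK H.
have [E|sq] := eqVneq (d j 0 * d j 0) (e j 0 * e j 0); last first.
  by exists (delta_mx j j); rewrite ?trmx_delta // !quad_delta.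
exists (delta_mx i j + delta_mx j i).
  by rewrite linearD /= !trmx_delta addrC.
have quadD (c : 'cV[K]_n.+1) :
    (c^T *m (delta_mx i j + delta_mx j i) *m c) 0 0 = c i 0 * (c j 0 + c j 0).
  by rewrite mulmxDr mulmxDl mxE !quad_delta mulrDr [c j 0 * _]mulrC.
rewrite !quadD -dei (inj_eq (mulfI di0)).
(* Equal squares and 2 d_j = 2 e_j together give (d_j - e_j) ^ 2 = 0. *)
apply: contraNneq dej => E2; rewrite -subr_eq0 -sqrf_eq0; apply/eqP.
transitivity (d j 0 * d j 0 - e j 0 * e j 0
              - e j 0 * ((d j 0 + d j 0) - (e j 0 + e j 0))); first by ring.
by rewrite E E2 !subrr mulr0 subrr.
Qed.

Lemma unipotent_SpM (S : 'M[K]_n.+1) : S^T = S ->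
  exists2 s, s \in SpM_pt_group K n & glmx s = block_mx 1%:M S 0 1%:M.
Proof.
move=> symS.
have uA : block_mx 1%:M S 0 1%:M \in unitmx.
  suff /mulmx1_unit[] :
    block_mx 1%:M S 0 1%:M *m block_mx 1%:M (- S) 0 1%:M = 1%:M by [].
  rewrite mulmx_block !mulmx0 !mul0mx !mulmx1 !mul1mx !addr0 add0r addNr.
  by rewrite -scalar_mx_block.
exists (FinRing.Unit (uA : block_mx 1%:M S 0 1%:M \is a GRing.unit)) => //.
set s := FinRing.Unit _.
have sE (x : V) : app s x = col_mx (usubmx x + S *m dsubmx x) (dsubmx x).
  rewrite /app -[in LHS](vsubmxK x) (_ : glmx s = block_mx 1%:M S 0 1%:M) //.
  by rewrite mul_block_col !mul1mx mul0mx add0r.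
apply/SpM_ptP; split=> [|x]; last first.
  by rewrite mem_Mspace sE => /eqP x0; rewrite x0 mulmx0 addr0 -[RHS]vsubmxK x0.
apply/SpP=> x y; rewrite !formE !sE !col_mxKu !col_mxKd.
rewrite linearD /= trmx_mul symS mulmxDl mulmxDr mulmxA.
by congr (fun_of_matrix _ 0 0); rewrite opprD addrACA subrr addr0.
Qed.

End Separation.

Section WeilAction.

Variables (K : finFieldType) (n : nat) (F : fieldType) (lam : addchar K F).

Local Notation V := 'cV[K]_(n.+1 + n.+1).
Local Notation gT := {'GL_(n.+1 + n.+1)[K]}.
Local Notation u := (u K).
Local Notation v := (v K).
Implicit Types (g s t w : gT) (x y : V) (i j k l : 'I_n.+1) (eps : bool).

Lemma addchar_neq0 a : lam a != 0.
Proof.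
apply: contraTneq (oner_neq0 F) => la0.
by rewrite -(addchar0 lam) -(subrr a) addcharD la0 mul0r eqxx.
Qed.

Lemma addchar_sep a b1 b2 : lam a != 1 -> b1 != b2 ->
  exists c, lam (c * b1) != lam (c * b2).
Proof.
move=> la; rewrite -subr_eq0 => b12; exists (a / (b1 - b2)).
apply: contraNneq la => E; apply/eqP/(mulIf (addchar_neq0 (a / (b1 - b2) * b2))).
by rewrite mul1r -[in RHS]E -addcharD; congr (lam _); field.
Qed.

Hypothesis lam_nontriv : exists a : K, lam a != 1.

(** An element of [Sp^M] has a block matrix with a symmetric upper right block
[S], and [form (app s x) x] is the value at [x] of the quadratic form of [S].
After rescaling [S], a difference between two such values is detected by the
nontrivial character [lam]. *)
Lemma SpM_pt_sep x y i : x \in Nspace K n -> y \in Nspace K n ->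
    form (u i) x = form (u i) y -> form (u i) x != 0 -> x != y ->
  exists2 s, s \in SpM_pt_group K n &
    lam (form (app s x) x) != lam (form (app s y) y).
Proof.
move=> Nx Ny; rewrite !form_u => xyi xi0 xy.
have [|||S symS neq] := @symmetric_quad_sep _ _ (dsubmx x) (dsubmx y) i.
- by rewrite !mxE.
- by rewrite mxE.
- apply: contraNneq xy => xyd; apply/eqP; rewrite -[x]vsubmxK -[y]vsubmxK xyd.
  by move: Nx Ny; rewrite !mem_Nspace => /eqP-> /eqP->.
have [a la] := lam_nontriv; have [c lc] := addchar_sep la neq.
have [|s ss sE] := @unipotent_SpM _ _ (c *: S); first by rewrite linearZ /= symS.
have fE (z : V) : z \in Nspace K n ->
    form (app s z) z = c * ((dsubmx z)^T *m S *m dsubmx z) 0 0.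
  rewrite mem_Nspace => /eqP z0; rewrite formE /app sE -{1 3}[z]vsubmxK.
  rewrite mul_block_col z0 !mul1mx mulmx0 add0r col_mxKu col_mxKd mulmx0 subr0.
  by rewrite -scalemxAl linearZ /= trmx_mul symS -scalemxAl mxE.
by exists s => //; rewrite !fE.
Qed.

Lemma Xact_Epm eps g x : g \in SpM_group K n -> x \in Nspace K n ->
  Xact lam g (Epm F eps x) =
    lam (form (app g x) (app (levi g) x)) *: Epm F eps (app (levi g) x).
Proof.
move=> gM Nx.
have EN : Xact lam g (E F (- x)) =
    lam (form (app g x) (app (levi g) x)) *: E F (- app (levi g) x).
  by rewrite Xact_E ?memvN // !appN formNl formNr opprK.
rewrite /Epm; case: ifP => _; first by rewrite Xact_E.
case: eps; first by rewrite linearD /= EN Xact_E // scalerDr.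
by rewrite linearB /= EN Xact_E // scalerBr.
Qed.

(** Since [s] fixes [M] pointwise, [form (app s y) y] depends only on [y] modulo
[M], and [app g x] is congruent to [app (levi g) x]. *)
Lemma chi_translate g s x : g \in SpM_group K n -> s \in SpM_pt_group K n ->
    x \in Nspace K n ->
  chi lam x (s ^ g) = chi lam (app (levi g) x) s.
Proof.
move=> gM spt Nx; congr (lam _).
have sM := subsetP (SpM_pt_sub K n) s spt.
have [_ sfix] := SpM_ptP _ spt.
rewrite conjgE !appM -(SpM_Sp gM) appVK.
have [m Mm ->] : exists2 m, m \in Mspace K n & app g x = app (levi g) x + m.
  by exists (app g x - app (levi g) x); rewrite ?app_levi_M // addrC subrK.
set y := app (levi g) x.
have -> : app s (y + m) = app s y + m by rewrite appD (sfix m Mm).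
have sym : form (app s y) m = form y m by rewrite -{1}(sfix m Mm) SpM_Sp.
by rewrite formDl !formDr sym form_alt addr0 [form m y]formC addrK.
Qed.

End WeilAction.

(** * The modules [Xpm_sub] *)

Section SliceModule.

Variables (K : finFieldType) (n : nat) (F : fieldType) (lam : addchar K F).
Variables (i : 'I_n.+1) (alpha : K).
Hypothesis lam_nontriv : exists a : K, lam a != 1.
Hypothesis alpha_neq0 : alpha != 0.

Local Notation V := 'cV[K]_(n.+1 + n.+1).
Local Notation gT := {'GL_(n.+1 + n.+1)[K]}.
Local Notation u := (u K).
Local Notation v := (v K).
Local Notation A := (slice alpha i).
Local Notation x0 := (alpha *: v i).
Local Notation W eps := (Xpm_sub F eps alpha i).
Implicit Types (g s t w : gT) (x y : V) (j k l : 'I_n.+1) (eps : bool).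

Lemma Xpm_sub_span eps : W eps = <<[seq Epm F eps x | x in A]>>%VS.
Proof.
apply: eq_span => f; apply/imageP/imageP => [[c _ ->]|[x Ax ->]].
  by exists (slice_vec alpha i c) => //; apply: slice_vec_slice.
exists [ffun k => form (u k) x] => //.
by rewrite [in LHS](slice_vecP Ax).
Qed.

(** The slice is disjoint from its opposite when -1 differs from 1, so the term
[E (- x)] of [Epm eps x] vanishes on it. *)
Lemma Epm_slice eps x y (Ny : y \in Nspace K n) : x \in A -> y \in A ->
  Epm F eps x (exist _ y Ny) = (x == y)%:R.
Proof.
move=> Ax Ay; rewrite /Epm eq_sym; case: ifPn => K2; first by rewrite ffunE.
by case: eps; rewrite !ffunE /= (slice_opp alpha_neq0 K2 Ax Ay) ?subr0 ?addr0.
Qed.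

Lemma Epm_slice_free eps : free [seq Epm F eps x | x in A].
Proof.
rewrite /image_mem -[map _ _]/(val (map_tuple (Epm F eps) (enum_tuple A))).
apply/freeP=> c /ffunP c0 a; have Aa := enum_valP a.
have [Na _ _] := sliceP _ _ _ Aa.
have nthE (b : 'I_#|A|) : (map_tuple (Epm F eps) (enum_tuple A))`_b =
    Epm F eps (enum_val b).
  rewrite -tnth_nth tnth_map; congr (Epm F eps _).
  rewrite (tnth_nth (enum_val b)) /= /enum_val.
  by apply: set_nth_default; rewrite -cardE.
have := c0 (exist (fun x => x \in Nspace K n) _ Na).
rewrite sum_ffunE (bigD1 a) //= big1 ?addr0 => [|b ba].
  by rewrite nthE !ffunE Epm_slice // eqxx [_ *: _]mulr1.
rewrite nthE ffunE Epm_slice ?enum_valP // (inj_eq enum_val_inj) (negbTE ba).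
by rewrite scaler0.
Qed.

Lemma dim_Xpm_sub eps : \dim (W eps) = #|A|.
Proof.
have := Epm_slice_free eps; rewrite /free -Xpm_sub_span => /eqP->.
by rewrite size_image.
Qed.

Lemma Xpm_sub_sub eps : (W eps <= Xpm K n F eps)%VS.
Proof.
rewrite Xpm_sub_span; apply/span_subvP=> _ /imageP[x Ax ->].
have [Nx _ _] := sliceP _ _ _ Ax.
by apply/memv_span/image_f; rewrite inE Nx (slice_neq0 alpha_neq0 Ax).
Qed.

Lemma Xpm_sub_submodule eps : submodule (X_U n lam) (W eps).
Proof.
move=> g Ug; rewrite Xpm_sub_span limg_span; apply/span_subvP.
move=> _ /mapP[_ /imageP[x Ax ->] ->]; have [Nx _ _] := sliceP _ _ _ Ax.
have gM := subsetP (U_subM K n) g Ug.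
rewrite [X_U n lam g _](Xact_Epm lam eps gM Nx).
by rewrite memvZ // memv_span // image_f // levi_slice.
Qed.

Lemma Epm_neq0 eps x : x \in A -> Epm F eps x != 0.
Proof.
move=> Ax; have := free_not0 (Epm_slice_free eps); apply.
exact: image_f.
Qed.

(** [T] is transitive on the slice and permutes the corresponding lines. *)
Lemma Xpm_sub_cyclic eps :
  (W eps <= <<[seq X_U n lam g (Epm F eps x0) | g in U_group K n]>>)%VS.
Proof.
rewrite Xpm_sub_span; apply/span_subvP=> _ /imageP[x Ax ->].
have [t Tt tx] := slice_trans alpha_neq0 Ax.
have Ut := subsetP (T_subU K n) t Tt.
have tM := subsetP (U_subM K n) t Ut.
have [Nv _ _] := sliceP _ _ _ (slice_v alpha i).
have := Xact_Epm lam eps tM Nv.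
rewrite (levi_id (subsetP (T_subMN K n) t Tt)) tx => tE.
rewrite -[Epm F eps x](scalerK (addchar_neq0 lam (form x x))) -tE.
by rewrite memvZ // memv_span //; apply/imageP; exists t.
Qed.

Section Stabilizer.

Variable w : gT.
Hypothesis Sw : w \in Sp_group K n.
Hypothesis wu : forall j, app w (u j) = u (cyc i j).
Hypothesis wv : forall j, app w (v j) = v (cyc i j).

Local Notation H := (Uw_group w).

Lemma Uw_fix g : g \in U_group K n -> (g \in H) = (app (levi g) x0 == x0).
Proof.
move=> Ug; apply/idP/eqP => [/(Uw_groupP Sw wu wv Ug) gv|].
  by rewrite appZ gv.
rewrite appZ => /(scalerI alpha_neq0) gv; exact/(Uw_groupP Sw wu wv Ug).
Qed.

Lemma Uw_chi eps h : h \in H ->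
  X_Uw lam w h (Epm F eps x0) = chi lam x0 h *: Epm F eps x0.
Proof.
move=> Hh; have Uh := subsetP (Uw_subU w) h Hh.
have hM := subsetP (U_subM K n) h Uh.
have [Nv _ _] := sliceP _ _ _ (slice_v alpha i).
rewrite [X_Uw lam w h _](Xact_Epm lam eps hM Nv).
by move: Hh; rewrite Uw_fix // => /eqP->.
Qed.

Lemma Uw_affords eps :
  affords_lin_char (X_Uw lam w) (Epm F eps x0) (chi lam x0).
Proof.
have nz := Epm_neq0 eps (slice_v alpha i).
split=> // [g h Hg Hh|h Hh]; last exact: Uw_chi.
have [_ rhoM] := lmod_funP (X_Uw lam w).
have := Uw_chi eps (groupM Hg Hh).
rewrite rhoM // comp_lfunE Uw_chi // linearZ /= Uw_chi // scalerA mulrC => /eqP.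
rewrite -subr_eq0 -scalerBl scaler_eq0 (negbTE nz) orbF subr_eq0.
by move=> /eqP->.
Qed.

Lemma Uw_line eps : submodule (X_Uw lam w) <[Epm F eps x0]>%VS.
Proof.
move=> h Hh; rewrite limg_line -memvE Uw_chi //.
by rewrite memvZ // memv_line.
Qed.

(** [Uw_group w] is the stabilizer of [alpha *: v i] in [U], which acts on the
slice through the Levi component: an orbit is no larger than the slice. *)
Lemma card_lcosets_Uw : (#|lcosets H (U_group K n)| <= #|A|)%N.
Proof.
pose f (C : {set gT}) := app (levi (repr C)) x0.
have reprU C : C \in lcosets H (U_group K n) ->
    repr C \in U_group K n /\ C = (repr C *: H)%g.
  case/lcosetsP=> g Ug ->; have : repr (g *: H)%g \in (g *: H)%g.
    by rewrite (mem_repr g) // lcoset_refl.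
  move=> rg; split; last exact/esym/lcoset_eqP.
  by case/lcosetP: rg => h Hh ->; rewrite groupM // (subsetP (Uw_subU w)).
have f_inj : {in lcosets H (U_group K n) &, injective f}.
  move=> C C' /reprU[Ur EC] /reprU[Ur' EC'] ff; rewrite EC EC'.
  apply/lcoset_eqP; rewrite mem_lcoset Uw_fix ?groupM ?groupV //.
  have rM := subsetP (U_subM K n) _ Ur; have rM' := subsetP (U_subM K n) _ Ur'.
  rewrite leviM ?groupV // appM -/(f C) ff -appM -leviM ?groupV //.
  by rewrite mulVg levi_pt ?group1 // app1.
rewrite -(card_in_imset f_inj).
apply/subset_leq_card/subsetP=> _ /imsetP[C cC ->].
by apply: levi_slice; [case/reprU: cC | apply: slice_v].
Qed.

Lemma Uw_inertia : {in U_group K n, forall g, g \notin H ->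
  exists2 s, s \in SpM_pt_group K n & chi lam x0 (s ^ g) != chi lam x0 s}.
Proof.
move=> g Ug; rewrite Uw_fix // => gx.
have gM := subsetP (U_subM K n) g Ug.
have [Nv iv _] := sliceP _ _ _ (slice_v alpha i).
have [Ny iy _] := sliceP _ _ _ (levi_slice Ug (slice_v alpha i)).
have [||s ss neq] := @SpM_pt_sep _ _ _ _ lam_nontriv _ _ i Ny Nv _ _ gx.
- by rewrite iy iv.
- by rewrite iy.
by exists s => //; rewrite chi_translate.
Qed.

Lemma SpM_pt_subUw : SpM_pt_group K n \subset H.
Proof.
apply/subsetP=> s ss; rewrite Uw_fix; last exact: (subsetP (mulG_subr _ _)).
by rewrite levi_pt // app1.
Qed.

Lemma line_repr_chi eps : {in H, forall h,
  sub_repr (@Uw_line eps) h = (chi lam x0 h)%:M}.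
Proof.
move=> h Hh; apply: sub_mx_scalar => x /vlineP[c ->].
by rewrite linearZ /= Uw_chi // !scalerA mulrC.
Qed.

Lemma dim_line eps : \dim <[Epm F eps x0]>%VS = 1%N.
Proof. by rewrite dim_vline Epm_neq0 ?slice_v. Qed.

(** The induced representation depends on the line only through its character
[chi], which is the same for both signs; so [eps] and [eps'] may differ. *)
Lemma Xpm_sub_ind_rsim eps eps' :
  mx_rsim (sub_repr (@Xpm_sub_submodule eps))
          (ind_repr (sub_repr (@Uw_line eps')) (Uw_subU w)).
Proof.
apply: (@sub_repr_ind_rsim _ _ _ _ _ (chi lam x0) _ _ (dim_line eps')
          (@line_repr_chi eps') _ _ (Epm F eps x0)).
- by move=> h Hh; apply: Uw_chi.
- exact: Xpm_sub_cyclic.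
by rewrite dim_Xpm_sub card_lcosets_Uw.
Qed.

Lemma Xpm_sub_abs_irr eps :
  mx_absolutely_irreducible (sub_repr (@Xpm_sub_submodule eps)).
Proof.
rewrite (mx_rsim_abs_irr (Xpm_sub_ind_rsim eps true)).
apply: (ind_lin_abs_irr _ (dim_line true) (@line_repr_chi true) SpM_pt_subUw).
  exact: subset_trans (U_subM K n) (SpM_norm K n).
exact: Uw_inertia.
Qed.

End Stabilizer.

End SliceModule.

Theorem theorem3p7 (K : finFieldType) (p n : nat) (F : fieldType)
    (lam : addchar K F) (i : 'I_n.+1) (alpha : K)
    (charK : p \in [pchar K]) (charF : p \notin [pchar F])
    (rootF : exists z : F, p.-primitive_root z)
    (lam_nontriv : exists a : K, lam a != 1)
    (alpha_neq0 : alpha != 0) :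
  (forall eps : bool,
     [/\ (Xpm_sub F eps alpha i <= Xpm K n F eps)%VS,
         \dim (Xpm_sub F eps alpha i) = (#|K| ^ (n.+1 - i.+1))%N
       & exists modX : submodule (X_U n lam) (Xpm_sub F eps alpha i),
           mx_absolutely_irreducible (sub_repr modX)])
  /\
  (forall w : {'GL_(n.+1 + n.+1)[K]},
     w \in Sp_group K n ->
     (forall j, app w (u K j) = u K (cyc i j)) ->
     (forall j, app w (v K j) = v K (cyc i j)) ->
     (forall eps : bool,
        affords_lin_char (X_Uw lam w) (Epm F eps (alpha *: v K i))
                         (chi lam (alpha *: v K i)))
     /\
     exists (modX : forall eps : bool,
               submodule (X_U n lam) (Xpm_sub F eps alpha i))
            (modL : forall eps : bool,
               submodule (X_Uw lam w) <[Epm F eps (alpha *: v K i)]>%VS),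
       [/\ mx_rsim (sub_repr (modX true))
                   (ind_repr (sub_repr (modL true)) (Uw_subU w)),
           mx_rsim (ind_repr (sub_repr (modL true)) (Uw_subU w))
                   (ind_repr (sub_repr (modL false)) (Uw_subU w))
         & mx_rsim (ind_repr (sub_repr (modL false)) (Uw_subU w))
                   (sub_repr (modX false))]).
Proof.
split=> [eps|w Sw wu wv].
  have [w [Sw wu wv]] := w_exists K i; split.
  - exact: Xpm_sub_sub.
  - by rewrite dim_Xpm_sub // card_slice.
  exists (@Xpm_sub_submodule _ _ _ lam i alpha eps).
  exact: (Xpm_sub_abs_irr lam_nontriv alpha_neq0 Sw wu wv).
split=> [eps|]; first exact: Uw_affords.
exists (@Xpm_sub_submodule _ _ _ lam i alpha).
exists (Uw_line lam alpha_neq0 Sw wu wv).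
have XL := Xpm_sub_ind_rsim lam alpha_neq0 Sw wu wv.
split; [exact: XL | | exact/mx_rsim_sym/XL].
exact: mx_rsim_trans (mx_rsim_sym (XL true true)) (XL true false).
Qed.
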